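(* Let $f$ be a convex function from an interval $I\subseteq\mathbb{R}$ to $\mathbb{R}$. Let $x_1,x_2,\ldots,x_n$ be finitely many points from $I$. Let $r$ be an integer. Let $w_1,w_2,\ldots,w_n$ be nonnegative reals. Extend the indices in $x_1,\ldots,x_n$ and in $w_1,\ldots,w_n$ cyclically modulo $n$: for any integer $i\notin\{1,2,\ldots,n\}$, define $x_i=x_j$ and $w_i=w_j$, where $j$ is the integer from $\{1,2,\ldots,n\}$ such that $i\equiv j\bmod n$. Let $w=\sum_{v=1}^n w_v$ and $x=\frac{\sum_{v=1}^n w_v x_v}{\sum_{v=1}^n w_v}$. Assume that $w\neq 0$ and that $w+(w_s-w_{s+r})\neq 0$ for every $s\in\{1,2,\ldots,n\}$. Then $$2\sum_{i=1}^n w_i f(x_i) + (n-2)\,w f(x) \geq \sum_{s=1}^n \left(w+(w_s-w_{s+r})\right) f\left(\frac{\sum_{v=1}^n w_vx_v+\left(w_sx_s-w_{s+r}x_{s+r}\right)}{w+(w_s-w_{s+r})}\right).$$ *)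

(* Defs.v *)
From HB Require Import structures.
From mathcomp Require Import all_boot all_order all_algebra.

Set Implicit Arguments.
Unset Strict Implicit.
Unset Printing Implicit Defensive.

Import Order.TTheory GRing.Theory Num.Theory.
Local Open Scope ring_scope.

(* A family a_1, ..., a_n is encoded as a : 'I_n -> V, with a_(k+1) = a k; this
   uniform shift of the indices preserves congruences mod n and offsets s + r.
   The default 0 is only reached when n = 0 (see cyclic_extE). *)
Definition cyclic_ext (V : nmodType) (n : nat) (a : 'I_n -> V) (i : int) : V :=
  if [pick j : 'I_n | (i == j%:Z %[mod n%:Z])%Z] is Some j then a j else 0.

Lemma cyclic_extE (V : nmodType) (n : nat) (a : 'I_n -> V) (i : int) (j : 'I_n) :
  (i = j%:Z %[mod n%:Z])%Z -> cyclic_ext a i = a j.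
Proof.
move=> ij; rewrite /cyclic_ext; case: pickP => [k /eqP ik|/(_ j)]; last first.
  by rewrite ij eqxx.
congr a; apply: val_inj; move: ik; rewrite ij !modz_nat !modn_small //.
by case.
Qed.

Lemma cyclic_ext_ord (V : nmodType) (n : nat) (a : 'I_n -> V) (i : int) :
  (0 < n)%N -> exists2 j : 'I_n, (i = j%:Z %[mod n%:Z])%Z & cyclic_ext a i = a j.
Proof.
move=> n_gt0; have n0 : n%:Z != 0 by rewrite eqz_nat -lt0n.
have lt_in : (`|(i %% n%:Z)%Z| < n)%N.
  by rewrite -ltz_nat gez0_abs ?modz_ge0 ?ltz_pmod // ltz_nat.
have ij : (i = (Ordinal lt_in)%:Z %[mod n%:Z])%Z.
  by rewrite /= gez0_abs ?modz_ge0 // modz_mod.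
by exists (Ordinal lt_in) => //; apply: cyclic_extE.
Qed.

(* Main.v *)
(** The inequality is linear in [f] and involves only finitely many points, and
    on a finite set of points a convex function agrees with an affine function
    plus a nonnegative combination of functions [p |-> `|p - t|].  Both sides
    agree on affine functions, so only [f p = `|p - t|] remains.  With
    [a v = w v * (x v - t)] and [S] the sum of the [a v], this says
    [sum_v `|S + a v - a (s v)| <= 2 sum_v `|a v| + (n - 2) `|S|] for the
    permutation [s] shifting the indices by [r]. *)
Require Import Defs.
From HB Require Import structures.
From mathcomp Require Import all_boot all_order all_algebra.
From mathcomp Require Import classical_sets set_interval reals convex.
From mathcomp Require Import interval_inference normedtype unstable.
From mathcomp Require Import fingroup perm ring lra.

Set Implicit Arguments.
Unset Strict Implicit.
Unset Printing Implicit Defensive.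

Import Order.TTheory GRing.Theory Num.Theory.
Local Open Scope classical_set_scope.
Local Open Scope ring_scope.

(** * The inequality for absolute values *)

Lemma sum_norm_perm_ge0 (R : realDomainType) (T : finType) (s : {perm T})
    (a : T -> R) :
  0 <= \sum_v a v ->
  \sum_v `|\sum_u a u + (a v - a (s v))| <=
  2 * \sum_v `|a v| + (#|T|%:R - 2) * `|\sum_v a v|.
Proof.
set S := \sum_v a v => S_ge0; rewrite (ger0_norm S_ge0).
(* If [b] marks the negative terms, the left-hand side is
   [n S - 2 sum_v b v (S + a v - a (s v))].  When some [b v = 1], the total
   weight of [S] drops to at most [n - 2], while each [a v] has coefficient
   [b v - b (s^-1 v)], which lies in [-1, 1]. *)
pose b v : R := (S + (a v - a (s v)) < 0)%R%:R.
have normE v : `|S + (a v - a (s v))|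
    = S + (a v - a (s v)) - 2 * (b v * S + b v * a v - b v * a (s v)).
  rewrite /b; case: ltP => [h|h] /=; last by rewrite ger0_norm //; ring.
  by rewrite ltr0_norm //; ring.
have perm_sum (h : T -> R) : \sum_v h (s v) = \sum_v h v.
  by rewrite [RHS](reindex_inj (@perm_inj _ s)).
have b_sum : \sum_v b v * a (s v) = \sum_v b ((s^-1)%g v) * a v.
  rewrite -[RHS]perm_sum; apply: eq_bigr => v _.
  by rewrite permK.
rewrite (eq_bigr _ (fun v _ => normE v)) !(big_split, sumrN) /= sumr_const.
rewrite perm_sum subrr addr0 -mulr_sumr !(big_split, sumrN) /= b_sum.
rewrite -mulr_suml -mulr_natl.
have [/existsP[v bv]|/existsPn b0] :=
    boolP [exists v, S + (a v - a (s v)) < 0]; last first.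
  (* With no negative term the left-hand side is [n S], so only [S <= sum_v |a v|] is needed. *)
  have {}b0 v : b v = 0 by rewrite /b (negPf (b0 v)).
  have S_le : S <= \sum_v `|a v|.
    by apply: ler_sum => v _; exact: ler_norm.
  have b_sum0 (p : T -> T) (h : T -> R) : \sum_v b (p v) * h v = 0.
    by rewrite big1 // => v _; rewrite b0 mul0r.
  have -> : \sum_v b v = 0 by rewrite big1.
  rewrite (b_sum0 id) b_sum0.
  by lra.
have b_ge0 u : 0 <= b u by rewrite /b ler0n.
have b_le1 u : b u <= 1 by rewrite /b lern1 leq_b1.
have b_ge1 : 1 <= \sum_u b u.
  by rewrite (bigD1 v) //= {1}/b bv lerDl sumr_ge0.
have bS : S <= (\sum_u b u) * S by rewrite ler_peMl.
have : - \sum_u `|a u| <= \sum_u (b u * a u - b ((s^-1)%g u) * a u).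
  rewrite -sumrN; apply: ler_sum => u _; rewrite -mulrBl lerNl.
  apply: le_trans (ler_norm _) _; rewrite normrN normrM ler_piMl //.
  have := b_ge0 u; have := b_le1 u.
  have := b_ge0 ((s^-1)%g u); have := b_le1 ((s^-1)%g u).
  by rewrite ler_norml => *; apply/andP; split; lra.
rewrite big_split sumrN /= => h.
by lra.
Qed.

(** Replacing [a] by [- a] changes no absolute value, so the sum may be taken nonnegative. *)
Lemma sum_norm_perm (R : realDomainType) (T : finType) (s : {perm T})
    (a : T -> R) :
  \sum_v `|\sum_u a u + (a v - a (s v))| <=
  2 * \sum_v `|a v| + (#|T|%:R - 2) * `|\sum_v a v|.
Proof.
have [|S_le0] := leP 0 (\sum_v a v); first exact: sum_norm_perm_ge0.
have N_ge0 : 0 <= \sum_v - a v by rewrite sumrN oppr_ge0 ltW.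
have := sum_norm_perm_ge0 s N_ge0; rewrite sumrN normrN.
under [X in _ <= 2 * X + _]eq_bigr do rewrite normrN.
by under [X in X <= _ -> _]eq_bigr do rewrite -!opprD normrN.
Qed.

(** * Convex functions on finite sets of points *)

Section ConvexCone.
Variables (R : realType) (I : interval R) (f : R -> R).
Hypothesis f_convex : convex_function ([set` I] : set R^o) f.

Lemma convex_function_three_points (a b c : R) : a \in I -> c \in I ->
  a < b -> b < c -> f b * (c - a) <= f a * (c - b) + f c * (b - a).
Proof.
move=> aI cI ab bc.
have ac : 0 < c - a by rewrite subr_gt0 (lt_trans ab).
have t0 : 0 <= (c - b) / (c - a) by rewrite divr_ge0 ?(ltW ac) // subr_ge0 ltW.
have t1 : (c - b) / (c - a) <= 1.
  by rewrite ler_pdivrMr // mul1r lerD2l lerN2 ltW.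
have := f_convex (Itv01 t0 t1) (mem_set aI) (mem_set cI).
rewrite convRE /= /onem.
have -> : conv (Itv01 t0 t1) (a : convex_lmodType R^o) c = b.
  by apply: etrans (convRE _ _ _) _; rewrite /= /onem; field; rewrite gt_eqF.
rewrite -(ler_pM2r ac) => /le_trans; apply; rewrite le_eqVlt; apply/orP; left.
by apply/eqP; field; rewrite gt_eqF.
Qed.

(* The kinks [q.2] avoid the leftmost point [z]: in the induction the function
   found for the tail is then affine up to its second point, so convexity of [f]
   makes the coefficient of the new kink nonnegative. *)
Lemma convex_function_sum_norm (z : R) (s : seq R) :
  path <%R z s -> {in z :: s, forall y, y \in I} ->
  exists (a b : R) (C : seq (R * R)),
    {in C, forall q, 0 <= q.1 /\ q.2 \in s} /\
    {in z :: s, forall p,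
      f p = a + b * p + \sum_(q <- C) q.1 * `|p - q.2|}.
Proof.
elim: s z => [|y s IHs] z /=.
  move=> _ _; exists (f z), 0, [::]; split=> // p; rewrite inE => /eqP ->.
  by rewrite big_nil mul0r !addr0.
move=> /andP[zy ys] sI.
case: s ys IHs sI => [|u s] ys IHs sI.
  exists (f y - (f y - f z) / (y - z) * y), ((f y - f z) / (y - z)), [::].
  split=> // p; rewrite big_nil !inE => /orP[]/eqP ->; last by ring.
  by field; rewrite subr_eq0 gt_eqF.
have [//|p ps|a [b [C [CP fE]]]] := IHs y.
  by apply: sI; rewrite inE ps orbT.
move: (ys) => /= /andP[yu us].
have Cu q : q \in C -> u <= q.2.
  move=> /CP[_]; rewrite inE => /predU1P[->//|qs].
  by have /allP/(_ _ qs)/ltW := order_path_min lt_trans us.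
pose g p := a + b * p + \sum_(q <- C) q.1 * `|p - q.2|.
have gE p : p <= u -> g p =
    (a + \sum_(q <- C) q.1 * q.2) + (b - \sum_(q <- C) q.1) * p.
  move=> pu; rewrite /g mulrBl mulr_suml addrACA -sumrB; congr (_ + _).
  apply: eq_big_seq => q /Cu uq.
  by rewrite ler0_norm ?subr_le0 ?(le_trans pu) // opprB mulrBr.
have zu : z <= u by rewrite ltW ?(lt_trans zy).
have fy : f y = g y by rewrite /g -fE ?mem_head.
have fu : f u = g u by rewrite /g -fE // !inE eqxx orbT.
(* Up to [u], [g] is the line through the points of the graph of [f] at [y] and [u]; by convexity
   [f z] lies on or above it. *)
have gz : g z <= f z.
  have := @convex_function_three_points z y u.
  rewrite !sI ?(mem_head, inE, eqxx, orbT) // => /(_ isT isT zy yu).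
  rewrite fy fu (gE z) // (gE y) ?(ltW yu) // gE // => h.
  rewrite -(@ler_pM2r _ (u - y)) ?subr_gt0 //.
  by move: h; lra.
(* The correction added to [g] is [k * (|p - y| - (p - y))]. It vanishes for [p >= y] and equals
   [2 * k * (y - z)] at [z], which fixes [k]. *)
pose k := (f z - g z) / (2 * (y - z)).
exists (a + k * y), (b - k), ((k, y) :: C); split=> [q|p].
  rewrite inE => /predU1P[->|/CP[c_ge0 cs]]; last first.
    by rewrite inE cs orbT.
  by rewrite mem_head divr_ge0 ?subr_ge0 // mulr_ge0 // subr_ge0 ltW.
rewrite big_cons /= inE => /predU1P[->|ps].
  rewrite ltr0_norm ?subr_lt0 //.
  have -> : f z = g z + 2 * k * (y - z).
    by rewrite /k; field; rewrite subr_eq0 gt_eqF.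
  by rewrite /g; ring.
have yp : y <= p.
  move: ps; rewrite inE => /predU1P[->//|ps].
  by have /allP/(_ _ ps)/ltW := order_path_min lt_trans ys.
rewrite fE // ger0_norm ?subr_ge0 //; ring.
Qed.

(** [L] is a signed measure, listed as pairs (mass, point). Zero total mass and zero first moment
    kill the affine part of [f], and each kink contributes a nonnegative amount. *)
Lemma convex_function_sum_ge0 (L : seq (R * R)) :
  {in L, forall q, q.2 \in I} ->
  \sum_(q <- L) q.1 = 0 -> \sum_(q <- L) q.1 * q.2 = 0 ->
  (forall t, 0 <= \sum_(q <- L) q.1 * `|q.2 - t|) ->
  0 <= \sum_(q <- L) q.1 * f q.2.
Proof.
move=> LI L0 L1 Ln.
pose s := sort <=%R (undup [seq q.2 | q <- L]).
have sL q : q \in L -> q.2 \in s.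
  by move=> qL; rewrite mem_sort mem_undup map_f.
have s_lt : sorted <%R s by rewrite lt_sorted_uniq_le sort_uniq undup_uniq /=
  sort_le_sorted.
have sI : {in s, forall y, y \in I}.
  by move=> y; rewrite mem_sort mem_undup => /mapP[q /LI ? ->].
case: s sL s_lt sI => [|z s] sL s_lt sI.
  by rewrite big1_seq // => q /andP[_ /sL].
have [a [b [C [CP fE]]]] := convex_function_sum_norm s_lt sI.
rewrite (eq_big_seq (fun q => a * q.1 + b * (q.1 * q.2) +
  \sum_(c <- C) c.1 * (q.1 * `|q.2 - c.2|))) => [|q /sL qs]; last first.
  rewrite fE // !mulrDr mulr_sumr (mulrC a) mulrCA; congr (_ + _).
  by apply: eq_bigr => c _; rewrite mulrCA.
rewrite !big_split /= -!mulr_sumr L0 L1 !mulr0 !add0r exchange_big /=.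
rewrite big_seq; apply: sumr_ge0 => c /CP[c_ge0 _].
by rewrite -mulr_sumr mulr_ge0.
Qed.

End ConvexCone.

(** * Weighted means and cyclic shifts *)

(** The mean lies between the least and the greatest [x i], which exist because a nonzero total
    weight forces [T] to be inhabited. *)
Lemma weighted_mean_itv (R : realFieldType) (I : interval R) (T : finType)
    (w x : T -> R) :
  (forall i, 0 <= w i) -> \sum_i w i != 0 -> (forall i, x i \in I) ->
  (\sum_i w i * x i) / \sum_i w i \in I.
Proof.
move=> w_ge0 w_neq0 xI.
have W_gt0 : 0 < \sum_i w i by rewrite lt_def w_neq0 sumr_ge0.
have [i0 _|T0] := pickP (@predT T); last by rewrite big_pred0 ?eqxx in w_neq0.
have [i _ i_min] := @arg_minP _ _ _ i0 predT x isT.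
have [j _ j_max] := @arg_maxP _ _ _ i0 predT x isT.
apply: (@interval_is_interval _ I _ _ (xI i) (xI j)); apply/andP; split.
  rewrite ler_pdivlMr // mulr_sumr; apply: ler_sum => k _.
  by rewrite mulrC ler_wpM2l // i_min.
rewrite ler_pdivrMr // mulr_sumr; apply: ler_sum => k _.
by rewrite mulrC ler_wpM2r //; exact: j_max.
Qed.

(** The permutation is chosen before the family, so that one [s] serves both the weights and the
    points. *)
Lemma cyclic_ext_shift (n : nat) (r : int) : exists s : {perm 'I_n},
  forall (V : nmodType) (a : 'I_n -> V) (i : 'I_n),
    cyclic_ext a (i%:Z + r) = a (s i).
Proof.
have /fin_all_exists[g gP] (i : 'I_n) :
    exists j : 'I_n, (i%:Z + r = j%:Z %[mod n%:Z])%Z.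
  have n_gt0 : (0 < n)%N by case: i => m; exact: leq_ltn_trans.
  by have [j ij _] := cyclic_ext_ord (fun=> 0 : int) (i%:Z + r) n_gt0; exists j.
have g_inj : injective g.
  move=> i j gij; have := gP j; rewrite -gij -gP => /eqP.
  rewrite eqz_modDr !modz_nat !modn_small // => /eqP[ji].
  exact/val_inj.
by exists (perm g_inj) => V a i; rewrite permE; apply: cyclic_extE.
Qed.

Theorem mainTheorem4 (R : realType) (I : interval R) (f : R -> R)
    (hf : convex_function ([set` I] : set R^o) f)
    (n : nat) (x : 'I_n -> R) (hx : forall i : 'I_n, x i \in I)
    (r : int) (w : 'I_n -> R) (hw : forall i : 'I_n, 0 <= w i) :
  let xe : int -> R := cyclic_ext x in
  let we : int -> R := cyclic_ext w in
  let W : R := \sum_(v < n) w v in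
  let X : R := (\sum_(v < n) w v * x v) / (\sum_(v < n) w v) in
  W != 0 ->
  (forall s : 'I_n, W + (w s - we (s%:Z + r)) != 0) ->
  2 * (\sum_(i < n) w i * f (x i)) + (n%:R - 2) * W * f X >=
  \sum_(s < n)
    (W + (w s - we (s%:Z + r))) *
    f ((\sum_(v < n) w v * x v
        + (w s * x s - we (s%:Z + r) * xe (s%:Z + r)))
       / (W + (w s - we (s%:Z + r)))).
Proof.
move=> xe we W X W_neq0 A_neq0.
have [g gE] := cyclic_ext_shift n r.
pose A s := W + (w s - w (g s)).
pose y s := (\sum_v w v * x v + (w s * x s - w (g s) * x (g s))) / A s.
have {}A_neq0 s : A s != 0 by rewrite /A -gE A_neq0.
under eq_bigr => s _.
  rewrite /we /xe !gE -/(A s) -/(y s).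
  over.
(* [y s] is the mean of the [x v] for the weights [c s], which are nonnegative
   also when [g s = s]. *)
pose c s v : R := w v * (1 + (v == s)%:R - (v == g s)%:R).
have c_ge0 s v : 0 <= c s v.
  by rewrite mulr_ge0 //; case: (v == s); case: (v == g s); rewrite /=; lra.
have c_sum s (h : 'I_n -> R) :
    \sum_v c s v * h v = \sum_v w v * h v + (w s * h s - w (g s) * h (g s)).
  have pick i : \sum_v (v == i)%:R * (w v * h v) = w i * h i.
    rewrite (bigD1 i) //= eqxx mul1r big1 ?addr0 // => v /negPf ->.
    by rewrite mul0r.
  rewrite -!pick -sumrB -big_split; apply: eq_bigr => v _ /=.
  by rewrite /c; ring.
have cE s : \sum_v c s v = A s.
  have := c_sum s (fun=> 1); rewrite /A /W !mulr1.
  under eq_bigr do rewrite mulr1.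
  by under [in X in _ = X]eq_bigr do rewrite mulr1.
have A_ge0 s : 0 <= A s by rewrite -cE sumr_ge0.
have yI s : y s \in I.
  by rewrite /y -c_sum -cE weighted_mean_itv // cE.
have XI : X \in I by exact: weighted_mean_itv.
have W_ge0 : 0 <= W by exact: sumr_ge0.
have WX : W * X = \sum_v w v * x v by rewrite /X mulrC divfK.
have Ay s : A s * y s = \sum_v w v * x v + (w s * x s - w (g s) * x (g s)).
  by rewrite /y mulrC divfK.
have sum_perm (h : 'I_n -> R) : \sum_s h (g s) = \sum_s h s.
  by rewrite [RHS](reindex_inj (@perm_inj _ g)).
(* The signed measure whose integral of [f] is the difference of the two sides. *)
pose L := [seq (2 * w i, x i) | i <- index_enum 'I_n] ++
  ((n%:R - 2) * W, X) :: [seq (- A s, y s) | s <- index_enum 'I_n].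
have LE (h : R -> R) : \sum_(q <- L) q.1 * h q.2 =
    2 * (\sum_i w i * h (x i)) + (n%:R - 2) * W * h X - \sum_s A s * h (y s).
  rewrite big_cat big_cons !big_map /= addrA -sumrN.
  congr (_ + _ + _); last by apply: eq_bigr => i _; rewrite mulNr.
  by rewrite mulr_sumr; apply: eq_bigr => i _; rewrite mulrA.
rewrite -subr_ge0 -LE.
apply: (convex_function_sum_ge0 hf) => [q||| t].
- by rewrite mem_cat inE => /or3P[/mapP[i _ ->]|/eqP ->|/mapP[s _ ->]] //=.
(* Total mass: the shifts cancel in [sum_s A s = n W], leaving [2 W + (n - 2) W - n W = 0]. *)
- under eq_bigr do rewrite -[_.1]mulr1.
  rewrite (LE (fun=> 1)).
  under eq_bigr do rewrite mulr1.
  under [X in _ - X]eq_bigr do rewrite mulr1.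
  rewrite !(big_split, sumrN) /= sum_perm sumr_const card_ord -/W.
  by rewrite -mulr_natl; ring.
(* First moment: likewise [sum_s A s * y s = n W X]. *)
- rewrite (LE id).
  under [X in _ - X]eq_bigr do rewrite Ay.
  rewrite !(big_split, sumrN) /= (sum_perm (fun s => w s * x s)) sumr_const.
  by rewrite card_ord -mulrA WX -mulr_natl; ring.
rewrite (LE (fun p => `|p - t|)) subr_ge0.
pose a v := w v * (x v - t).
have aE : \sum_v a v = W * (X - t).
  rewrite mulrBr WX /W mulr_suml -sumrB.
  by apply: eq_bigr => v _; exact: mulrBr.
have := sum_norm_perm g a; rewrite card_ord aE normrM (ger0_norm W_ge0) mulrA.
have -> : \sum_v `|a v| = \sum_v w v * `|x v - t|.
  by apply: eq_bigr => v _; rewrite normrM ger0_norm.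
apply: le_trans; rewrite le_eqVlt; apply/orP; left; apply/eqP.
(* Being nonnegative, [A s] moves inside the absolute value, and [A s * (y s - t) = W * (X - t) + (a
   s - a (g s))]. *)
apply: eq_bigr => s _; rewrite -{1}(ger0_norm (A_ge0 s)) -normrM.
by rewrite mulrBr Ay -WX /A /a; congr `|_|; ring.
Qed.
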